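(* Let $\Omega\subset\mathbb{H}_s^n$ be self-stem-preserving. Then the set $\mathcal{PS}(\Omega)$ of path-slice functions $\Omega\to\mathbb{H}$, equipped with the usual (pointwise) addition and real scalar multiplication and with the $*$-product, is an associative unitary real algebra.
   Context: Let $n$ be a positive integer, $\mathbb{H}$ the quaternions, $\mathbb{S}:=\{I\in\mathbb{H}: I^2=-1\}$, $\mathbb{C}_I:=\mathbb{R}+\mathbb{R}I$, $\mathbb{C}_I^n:=(\mathbb{C}_I)^n$ and $\mathbb{H}_s^n:=\bigcup_{I\in\mathbb{S}}\mathbb{C}_I^n\subset\mathbb{H}^n$. For $I\in\mathbb{S}$ let $\Psi_i^I:\mathbb{C}^n\to\mathbb{C}_I^n$, $x+yi\mapsto x+yI$ ($x,y\in\mathbb{R}^n$). Let $\mathscr{P}(\mathbb{C}^n)$ be the set of continuous paths $\gamma:[0,1]\to\mathbb{C}^n$ with $\gamma(0)\in\mathbb{R}^n$; put $\gamma^I:=\Psi_i^I\circ\gamma$, and write $\gamma^I\subset\Omega$ if $\gamma^I([0,1])\subset\Omega$. For $\Omega\subset\mathbb{H}_s^n$ let $\mathscr{P}(\mathbb{C}^n,\Omega):=\{\gamma\in\mathscr{P}(\mathbb{C}^n):\exists I\in\mathbb{S},\ \gamma^I\subset\Omega\}$, and for $\gamma\in\mathscr{P}(\mathbb{C}^n)$ let $\mathbb{S}(\Omega,\gamma):=\{I\in\mathbb{S}:\gamma^I\subset\Omega\}$. A function $f:\Omega\to\mathbb{H}$ is path-slice if there is a function $F:\mathscr{P}(\mathbb{C}^n,\Omega)\to\mathbb{H}^{2\times1}$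 with $f(\gamma^I(1))=(1,I)F(\gamma)$ for all $\gamma\in\mathscr{P}(\mathbb{C}^n,\Omega)$ and $I\in\mathbb{S}(\Omega,\gamma)$. $\Omega$ is real-path-connected if for every $q\in\Omega$ there are $\gamma\in\mathscr{P}(\mathbb{C}^n,\Omega)$ and $I\in\mathbb{S}(\Omega,\gamma)$ with $\gamma^I(1)=q$. $\Omega$ is self-stem-preserving if it is real-path-connected and is $\Omega$-stem-preserving, meaning: (i) $|\mathbb{S}(\Omega,\gamma)|\geq 2$ for every $\gamma\in\mathscr{P}(\mathbb{C}^n,\Omega)$, and (ii) $|\mathbb{S}(\Omega,\alpha)\cap\mathbb{S}(\Omega,\beta)|\neq 1$ for all $\alpha,\beta\in\mathscr{P}(\mathbb{C}^n,\Omega)$ with $\alpha(1)=\beta(1)$. Let $\Omega$ be self-stem-preserving and $g\in\mathcal{PS}(\Omega)$. For $\gamma\in\mathscr{P}(\mathbb{C}^n,\Omega)$ put $F_{\Omega}^g(\gamma):=\begin{pmatrix}1&I\\1&J\end{pmatrix}^{-1}\begin{pmatrix}g(\gamma^I(1))\\ g(\gamma^J(1))\end{pmatrix}$ for any $I\neq J$ in $\mathbb{S}(\Omega,\gamma)$ (independent of the choice), where $\begin{pmatrix}1&I\\1&J\end{pmatrix}^{-1}=(I-J)^{-1}\begin{pmatrix}I&-J\\1&-1\end{pmatrix}$. Define $\mathfrak{I}:\mathbb{H}_s^n\to\mathbb{S}\cup\{0\}$ by $\mathfrak{I}(q)=0$ if $q\in\mathbb{R}^n$, and otherwise $\mathfrak{I}(q)=\frac{q_\imath-\mathrm{Re}(q_\imath)}{|q_\imath-\mathrm{Re}(q_\imath)|}$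 with $\imath$ the smallest index for which $q_\imath\notin\mathbb{R}$. Define $\mathscr{F}_{\Omega}^g:\Omega\to\mathbb{H}^{2\times 1}$ by $\mathscr{F}_{\Omega}^g(q)=(g(q),0)^T$ if $q\in\mathbb{R}^n$, and $\mathscr{F}_{\Omega}^g(q)=F_{\Omega}^g(\gamma)$ otherwise, where $\gamma\in\mathscr{P}(\mathbb{C}^n,\Omega)$ is any path with $\gamma^{\mathfrak{I}(q)}\subset\Omega$ and $\gamma^{\mathfrak{I}(q)}(1)=q$ (such a path exists and the value is independent of the choice). For $f,g\in\mathcal{PS}(\Omega)$ the $*$-product $f*g:\Omega\to\mathbb{H}$ is $(f*g)(q):=(f(q),\mathfrak{I}(q)f(q))\,\mathscr{F}_{\Omega}^{g}(q)$ (row vector times column vector). *)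

(* Defs.v *)
From HB Require Import structures.
From mathcomp Require Import all_boot all_order all_algebra.
From mathcomp Require Import all_classical all_reals all_analysis.
From mathcomp Require Import complex ring lra.

Set Implicit Arguments.
Unset Strict Implicit.
Unset Printing Implicit Defensive.

Import Order.TTheory GRing.Theory Num.Theory.
Import numFieldNormedType.Exports.

Local Open Scope classical_set_scope.
Local Open Scope card_scope.
Local Open Scope ring_scope.

(* Quaternion a b c d is a + b i + c j + d k. *)
Record quaternion (R : Type) := Quaternion { q0 : R; q1 : R; q2 : R; q3 : R }.

Section QuaternionChoice.
Variable R : Type.

Definition tuple_of_quaternion (q : quaternion R) :=
  (q0 q, q1 q, q2 q, q3 q).
Definition quaternion_of_tuple (t : R * R * R * R) :=
  let: (a, b, c, d) := t in Quaternion a b c d.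

Lemma tuple_of_quaternionK : cancel tuple_of_quaternion quaternion_of_tuple.
Proof. by case. Qed.

End QuaternionChoice.

HB.instance Definition _ (R : eqType) :=
  Equality.copy (quaternion R) (can_type (@tuple_of_quaternionK R)).
HB.instance Definition _ (R : choiceType) :=
  Choice.copy (quaternion R) (can_type (@tuple_of_quaternionK R)).

Section QuaternionAlgebra.
Variable R : realType.
Local Notation H := (quaternion R).
Implicit Types p q r : H.

Definition addq p q :=
  Quaternion (q0 p + q0 q) (q1 p + q1 q) (q2 p + q2 q) (q3 p + q3 q).
Definition oppq p := Quaternion (- q0 p) (- q1 p) (- q2 p) (- q3 p).
Definition mulq p q := Quaternion
  (q0 p * q0 q - q1 p * q1 q - q2 p * q2 q - q3 p * q3 q)
  (q0 p * q1 q + q1 p * q0 q + q2 p * q3 q - q3 p * q2 q)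
  (q0 p * q2 q - q1 p * q3 q + q2 p * q0 q + q3 p * q1 q)
  (q0 p * q3 q + q1 p * q2 q - q2 p * q1 q + q3 p * q0 q).
Definition scaleq (a : R) p := Quaternion (a * q0 p) (a * q1 p) (a * q2 p) (a * q3 p).
Definition zeroq : H := Quaternion 0 0 0 0.
Definition oneq : H := Quaternion 1 0 0 0.
Definition sqnormq p := q0 p ^+ 2 + q1 p ^+ 2 + q2 p ^+ 2 + q3 p ^+ 2.
Definition invq p :=
  scaleq (sqnormq p)^-1 (Quaternion (q0 p) (- q1 p) (- q2 p) (- q3 p)).

Fact addqA : associative addq.
Proof. by case=> ? ? ? ? [? ? ? ?] [? ? ? ?]; congr Quaternion => /=; ring. Qed.
Fact addqC : commutative addq.
Proof. by case=> ? ? ? ? [? ? ? ?]; congr Quaternion => /=; ring. Qed.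
Fact add0q : left_id zeroq addq.
Proof. by case=> ? ? ? ?; congr Quaternion => /=; ring. Qed.
Fact addNq : left_inverse zeroq oppq addq.
Proof. by case=> ? ? ? ?; congr Quaternion => /=; ring. Qed.

HB.instance Definition _ := GRing.isZmodule.Build H addqA addqC add0q addNq.

Fact mulqA : associative mulq.
Proof. by case=> ? ? ? ? [? ? ? ?] [? ? ? ?]; congr Quaternion => /=; ring. Qed.
Fact mul1q : left_id oneq mulq.
Proof. by case=> ? ? ? ?; congr Quaternion => /=; ring. Qed.
Fact mulq1 : right_id oneq mulq.
Proof. by case=> ? ? ? ?; congr Quaternion => /=; ring. Qed.
Fact mulqDl : left_distributive mulq addq.
Proof. by case=> ? ? ? ? [? ? ? ?] [? ? ? ?]; congr Quaternion => /=; ring. Qed.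
Fact mulqDr : right_distributive mulq addq.
Proof. by case=> ? ? ? ? [? ? ? ?] [? ? ? ?]; congr Quaternion => /=; ring. Qed.
Fact oneq_neq0 : oneq != zeroq.
Proof. by apply/eqP => -[] /eqP; rewrite oner_eq0. Qed.

HB.instance Definition _ :=
  GRing.Zmodule_isNzRing.Build H mulqA mul1q mulq1 mulqDl mulqDr oneq_neq0.

Fact scaleqA a b p : scaleq a (scaleq b p) = scaleq (a * b) p.
Proof. by case: p => ? ? ? ?; congr Quaternion => /=; ring. Qed.
Fact scale1q : left_id 1 scaleq.
Proof. by case=> ? ? ? ?; congr Quaternion => /=; ring. Qed.
Fact scaleqDr : right_distributive scaleq +%R.
Proof. by move=> ? [? ? ? ?] [? ? ? ?]; congr Quaternion => /=; ring. Qed.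
Fact scaleqDl p : {morph scaleq^~ p : a b / a + b}.
Proof. by case: p => ? ? ? ? ? ?; congr Quaternion => /=; ring. Qed.

HB.instance Definition _ :=
  GRing.Zmodule_isLmodule.Build R H scaleqA scale1q scaleqDr scaleqDl.

Fact scaleqAl (a : R) p q : a *: (p * q) = (a *: p) * q.
Proof. by case: p q => ? ? ? ? [? ? ? ?]; congr Quaternion => /=; ring. Qed.
HB.instance Definition _ := GRing.Lmodule_isLalgebra.Build R H scaleqAl.

Fact scaleqAr (a : R) p q : a *: (p * q) = p * (a *: q).
Proof. by case: p q => ? ? ? ? [? ? ? ?]; congr Quaternion => /=; ring. Qed.
HB.instance Definition _ := GRing.Lalgebra_isAlgebra.Build R H scaleqAr.

Fact sqnormq_eq0 p : (sqnormq p == 0) = (p == 0).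
Proof.
apply/eqP/eqP => [|->]; last by rewrite /sqnormq /= expr0n /= !addr0.
case: p => a b c d; rewrite /sqnormq /= => h.
by congr Quaternion; apply/eqP; rewrite -sqrf_eq0; apply/eqP; nra.
Qed.

Definition unitq : pred H := [pred p | p != 0].

Fact mulVq : {in unitq, left_inverse 1 invq *%R}.
Proof.
move=> p; rewrite !inE -sqnormq_eq0; case: p => a b c d; rewrite /sqnormq /= => nz.
by congr Quaternion; rewrite /= /sqnormq /=; field.
Qed.
Fact mulqV : {in unitq, right_inverse 1 invq *%R}.
Proof.
move=> p; rewrite !inE -sqnormq_eq0; case: p => a b c d; rewrite /sqnormq /= => nz.
by congr Quaternion; rewrite /= /sqnormq /=; field.
Qed.
Fact unitqP p q : q * p = 1 /\ p * q = 1 -> unitq p.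
Proof.
by case=> + _ /=; apply: contra_eq_neq => ->; rewrite mulr0 eq_sym oner_neq0.
Qed.
Fact invq_out : {in [predC unitq], invq =1 id}.
Proof.
move=> p; rewrite !inE negbK => /eqP ->.
by congr Quaternion; rewrite /= ?oppr0 mulr0.
Qed.

HB.instance Definition _ :=
  GRing.NzRing_hasMulInverse.Build H mulVq mulqV unitqP invq_out.

Definition normq p : R := Num.sqrt (sqnormq p).

End QuaternionAlgebra.

Section Slices.
Variables (R : realType) (n : nat).
Local Notation H := (quaternion R).
Local Notation Hn := 'rV[quaternion R]_n.
(* R[i] carries its topology through its regular-module alias. *)
Local Notation Cn := 'rV[(R[i])^o]_n.

Definition isrealq (q : H) : bool := q == (q0 q)%:A.

Definition realHn (q : Hn) : bool := [forall j, isrealq (q 0 j)].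

Definition sphere : set H := [set I | I ^+ 2 = -1].

Definition slice_plane (I : H) : set H := [set a%:A + b *: I | a in setT & b in setT].

Definition slice_cone : set Hn :=
  \bigcup_(I in sphere) [set q : Hn | forall j, slice_plane I (q 0 j)].

Definition slice_embed (I : H) (z : Cn) : Hn :=
  \row_j ((complex.Re (z 0 j))%:A + complex.Im (z 0 j) *: I).

Local Notation unit_interval := (`[0, 1]%classic : set R).

Fact zero_in_unit_interval : (0 : R) \in unit_interval.
Proof. by rewrite inE /= in_itv /= lexx ler01. Qed.
Fact one_in_unit_interval : (1 : R) \in unit_interval.
Proof. by rewrite inE /= in_itv /= lexx ler01. Qed.

Definition t0 : unit_interval := exist _ 0 zero_in_unit_interval.
Definition t1 : unit_interval := exist _ 1 one_in_unit_interval.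

Record cpath := CPath {
  cpath_fun :> unit_interval -> Cn;
  cpath_continuous : continuous cpath_fun;
  cpath_start : forall j, complex.Im (cpath_fun t0 0 j) = 0 }.

Implicit Types (Om : set Hn) (g : cpath) (I J : H).

Definition lift g I : unit_interval -> Hn := slice_embed I \o g.

Definition path_units Om g : set H :=
  [set I | sphere I /\ range (lift g I) `<=` Om].

Definition paths_in Om : set cpath := [set g | path_units Om g !=set0].

Definition real_path_connected Om : Prop :=
  forall q, Om q ->
    exists2 g, paths_in Om g & exists2 I, path_units Om g I & lift g I t1 = q.

Definition stem_preserving Om : Prop :=
  (forall g, paths_in Om g -> `I_2 #<= path_units Om g) /\
  (forall a b, paths_in Om a -> paths_in Om b -> a t1 = b t1 ->
     ~ (path_units Om a `&` path_units Om b #= `I_1)).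

Definition self_stem_preserving Om : Prop :=
  real_path_connected Om /\ stem_preserving Om.

Definition col2 (x y : H) : 'cV[H]_2 := \col_i [:: x; y]`_i.
Definition row2 (x y : H) : 'rV[H]_2 := \row_j [:: x; y]`_j.
Definition mx2 (x y z t : H) : 'M[H]_2 :=
  \matrix_(i, j) (nth [::] [:: [:: x; y]; [:: z; t]] i)`_j.

Section PathSlice.
Variable Om : set Hn.

Definition path_slice (f : Om -> H) : Prop :=
  exists F : paths_in Om -> 'cV[H]_2,
    forall (g : paths_in Om) I, path_units Om (\val g) I ->
      forall q : Om, \val q = lift (\val g) I t1 ->
        f q = (row2 1 I *m F g) 0 0.

(* The inverse of mx2 1 I 1 J, for distinct I and J in the sphere. *)
Definition inv_slice_mx I J : 'M[H]_2 := (I - J)^-1 *: mx2 I (- J) 1 (-1).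

(* "For any I <> J": the value is chosen among those given by all the
   admissible pairs, which coincide when f is path-slice. *)
Definition stem_value (f : Om -> H) (g : cpath) : 'cV[H]_2 :=
  xget 0 [set v | exists I J (p q : Om),
    [/\ I <> J, path_units Om g I, path_units Om g J,
        \val p = lift g I t1 /\ \val q = lift g J t1
      & v = inv_slice_mx I J *m col2 (f p) (f q)]].

Definition slice_unit (q : Hn) : H :=
  if [pick j | ~~ isrealq (q 0 j) &
        [forall k : 'I_n, (k < j)%N ==> isrealq (q 0 k)]] is Some j
  then let v := q 0 j - (q0 (q 0 j))%:A in (normq v)^-1 *: v
  else 0.

(* As for stem_value, the choice of the path does not matter when f is
   path-slice and Om is self-stem-preserving. *)
Definition point_stem (f : Om -> H) (q : Om) : 'cV[H]_2 :=
  if realHn (\val q) then col2 (f q) 0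
  else xget 0 [set v | exists g, [/\ paths_in Om g,
    range (lift g (slice_unit (\val q))) `<=` Om,
    lift g (slice_unit (\val q)) t1 = \val q & v = stem_value f g]].

Definition star (f g : Om -> H) : Om -> H := fun q =>
  (row2 (f q) (slice_unit (\val q) * f q) *m point_stem g q) 0 0.

End PathSlice.

End Slices.

Arguments slice_cone : clear implicits.
Arguments path_slice {R n} Om f.
Arguments star {R n} Om f g.

(* A, with the operations of the ambient module V and the product mul, is an
   associative unitary K-algebra.  The library's algType is not used because it
   requires 1 != 0, which fails for functions on the empty set. *)
Definition assoc_unital_algebra (K : comPzRingType) (V : lmodType K)
    (A : set V) (mul : V -> V -> V) : Prop :=
  [/\ [/\ A 0, (forall u v, A u -> A v -> A (u + v)),
          (forall u, A u -> A (- u))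
        & (forall a u, A u -> A (a *: u))],
      (forall u v, A u -> A v -> A (mul u v)),
      (forall a u v w, A u -> A v -> A w ->
         mul (a *: u + v) w = a *: mul u w + mul v w /\
         mul w (a *: u + v) = a *: mul w u + mul w v),
      (forall u v w, A u -> A v -> A w -> mul u (mul v w) = mul (mul u v) w)
    & (exists2 e, A e & forall u, A u -> mul e u = u /\ mul u e = u)].

(* Main.v *)
(* On a self-stem-preserving set a path-slice function f is the same thing as a
   pair (A, B) of functions of the path with f = A + I B at the endpoint of the
   I-lift.  Since every path has two admissible units, (A, B) is determined by
   f, and two paths with a common lifted endpoint share two units, so their stems
   agree.  The star product then multiplies stems by the rule of complex
   multiplication, (A, B)(C, D) = (AC - BD, AD + BC), and the algebra axioms are
   those of the pairs. *)
Require Import Defs.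
From mathcomp Require Import all_boot all_order all_algebra.
From mathcomp Require Import all_classical all_reals all_analysis.
From mathcomp Require Import complex lra.
Import Order.TTheory GRing.Theory Num.Theory.
Import numFieldNormedType.Exports.
(* Otherwise normq and lift would be those of rat and fintype. *)
Import Defs.
Set Implicit Arguments.
Unset Strict Implicit.
Unset Printing Implicit Defensive.
Local Open Scope classical_set_scope.
Local Open Scope card_scope.
Local Open Scope ring_scope.

Lemma card_neq1_distinct (T : Type) (A : set T) x :
  ~ (A #= `I_1) -> A x -> exists2 y, x <> y & A y.
Proof.
move=> nA Ax; apply: contrapT => h; apply: nA.
suff -> : A = [set x] by exact: card_set1.
apply/seteqP; split=> [y Ay|y ->//]; apply: contrapT => xy; apply: h.
by exists y => // /esym.
Qed.

(** * Imaginary units and slice coordinates *)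

Section Sphere.
Variable R : realType.
Local Notation H := (quaternion R).
Implicit Types I J K : H.

(** If the real part [a] were nonzero, the imaginary entries [a * x + x * a] of the square would
    force [b], [c], [d] to vanish, leaving [a] with square -1. *)
Lemma sphere_coord I : sphere I ->
  q0 I = 0 /\ q1 I ^+ 2 + q2 I ^+ 2 + q3 I ^+ 2 = 1.
Proof.
case: I => a b c d; rewrite /sphere /= expr2 => -[h0 h1 h2 h3].
suff a0 : a = 0 by split=> //; rewrite a0 in h0; nra.
have [//|a0] := eqVneq a 0.
have hz x : a * x + x * a = 0 -> x = 0.
  move=> hx; apply/eqP; have : a * x = 0 by lra.
  by move/eqP; rewrite mulf_eq0 (negbTE a0).
have b0 : b = 0 by apply: hz; lra.
have c0 : c = 0 by apply: hz; lra.
have d0 : d = 0 by apply: hz; lra.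
by rewrite b0 c0 d0 in h0; nra.
Qed.

Lemma sphereN I : sphere I -> sphere (- I).
Proof. by rewrite /sphere /= sqrrN. Qed.

Lemma sphere_sqr I : sphere I -> I * I = -1.
Proof. by rewrite /sphere /= expr2. Qed.

Lemma sphere_neq0 I : sphere I -> I != 0.
Proof.
move=> /sphere_sqr h; apply/eqP => I0; move/eqP: h.
by rewrite I0 mulr0 eq_sym oppr_eq0 oner_eq0.
Qed.

Lemma subq_unit I J : I <> J -> I - J \is a GRing.unit.
Proof. by move=> /eqP IJ; rewrite -subr_eq0 in IJ. Qed.

(** Subtracting the equations leaves [(I - J) * b = (I - J) * d], and [I - J] is invertible. *)
Lemma slice_coef_unique I J (a b c d : H) : I <> J ->
  a + I * b = c + I * d -> a + J * b = c + J * d -> a = c /\ b = d.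
Proof.
move=> /subq_unit IJ hI hJ.
have bd : b = d.
  apply: (mulrI IJ); rewrite !mulrBl.
  have := congr2 (fun x y : H => x - y) hI hJ.
  by rewrite [a + _]addrC [c + _]addrC !addrKA.
by split=> //; move: hI; rewrite bd => /addIr.
Qed.

(** After left multiplication by [I - J], the top entry is [(I - J) * a] because [I * I = J * J],
    and the bottom one is [(I - J) * b]. *)
Lemma inv_slice_mxE I J (a b : H) : sphere I -> sphere J -> I <> J ->
  inv_slice_mx I J *m col2 (a + I * b) (a + J * b) = col2 a b.
Proof.
move=> /sphere_sqr I2 /sphere_sqr J2 /subq_unit IJ.
apply/matrixP => i j; rewrite !mxE big_ord_recl big_ord1 !mxE.
apply: (mulrI IJ); rewrite mulrDr !mulrA mulrV // !mul1r.
case: i => -[|[|//]] ? /=.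
  by rewrite !mulrDr !mulNr !mulrA I2 J2 addrACA subrr addr0 mulrBl.
by rewrite mul1r mulN1r [a + I * b]addrC addrKA mulrBl.
Qed.

Lemma isrealq_slice I (a b : R) : sphere I ->
  isrealq (a%:A + b *: I) = (b == 0).
Proof.
move=> sI; have [I0 _] := sphere_coord sI; rewrite /isrealq.
have -> : q0 (a%:A + b *: I) = a by rewrite /= I0 mulr1 mulr0 addr0.
rewrite addrC -subr_eq0 addrK scaler_eq0.
by rewrite (negbTE (sphere_neq0 sI)) orbF.
Qed.

Lemma normq_scale_sphere I (b : R) : sphere I -> normq (b *: I) = `|b|.
Proof.
move=> /sphere_coord [I0 I1]; rewrite /normq /sqnormq /= I0 -sqrtr_sqr.
congr Num.sqrt; rewrite mulr0 expr0n /= add0r !exprMn -!mulrDr.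
by rewrite I1 mulr1.
Qed.

End Sphere.

(** * Slice embeddings and conjugate paths *)

Section Embedding.
Variables (R : realType) (n : nat).
Local Notation H := (quaternion R).
Local Notation Cn := 'rV[(R[i])^o]_n.
Implicit Types (I : H) (z : Cn).

Lemma slice_embed_inj I : sphere I -> injective (@slice_embed R n I).
Proof.
move=> sI z w /rowP zw; apply/rowP => j; move: (zw j); rewrite !mxE.
have [I0 _] := sphere_coord sI.
move=> e; have := congr1 (@q0 R) e; rewrite /= I0 !mulr1 !mulr0 !addr0 => e0.
move: e; rewrite e0 => /addrI /eqP; rewrite -subr_eq0 -scalerBl scaler_eq0.
rewrite (negbTE (sphere_neq0 sI)) orbF subr_eq0 => /eqP e1.
by move: e0 e1; case: (z 0 j) (w 0 j) => [? ?] [? ?] /= -> ->.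
Qed.

Lemma realHn_embed I z : sphere I ->
  realHn (slice_embed I z) = [forall j, complex.Im (z 0 j) == 0].
Proof. by move=> sI; apply: eq_forallb => j; rewrite mxE isrealq_slice. Qed.

(** The first nonreal coordinate is [a + b I] with [b] nonzero, and normalising [b I] leaves only
    the sign of [b]. *)
Lemma slice_unit_embed I z : sphere I -> ~~ realHn (slice_embed I z) ->
  slice_unit (slice_embed I z) = I \/ slice_unit (slice_embed I z) = - I.
Proof.
move=> sI /forallPn[j0 j0P]; rewrite /slice_unit.
case: pickP => [j /andP[+ _]|]; last first.
  (* The least nonreal index would satisfy the test, so [pick] cannot fail. *)
  pose nonreal j := ~~ isrealq (slice_embed I z 0 j).
  case: (@arg_minnP _ j0 nonreal val j0P) => j jP jmin /(_ j).
  rewrite /nonreal in jP jmin.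
  rewrite jP /= => /negP[]; apply/forallP => k; apply/implyP => kj.
  by apply: contraLR kj => /jmin; rewrite -leqNgt.
rewrite mxE isrealq_slice //; set b := complex.Im _; set a := complex.Re _ => b0.
have [I0 _] := sphere_coord sI.
have -> : q0 (a%:A + b *: I) = a by rewrite /= I0 mulr1 mulr0 addr0.
rewrite addrC addrA addNr add0r normq_scale_sphere // scalerA.
have [bp|bn] := ger0P b; [left|right].
  by rewrite mulVf // scale1r.
by rewrite -[X in _ * X]opprK mulrN mulVf ?oppr_eq0 // scaleN1r.
Qed.

(** Conjugation turns lifts along [I] into lifts along [- I], which is needed when [slice_unit]
    returns [- I]. *)
Definition conj_vec z : Cn := \row_j (conjc (z 0 j) : (R[i])^o).

Lemma conj_vec_continuous : continuous conj_vec.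
Proof.
move=> z; apply/(@cvg_ballP _ _ _ (nbhs z) (nbhs_filter z)) => e e0.
have : \forall w \near z, ball z e w by exact: nbhsx_ballx.
apply: filterS => w [_ zw]; split=> // i j.
have := zw i j; rewrite -!ball_normE /= !mxE !ord1.
(* Restated with the modulus of [R[i]] itself, the bound follows since conjugation is an
   isometry. *)
by rewrite -[X in _ -> X]/(is_true (`|conjc _ - conjc _| < e)) -rmorphB normcJ.
Qed.

Lemma slice_embed_conj I z : slice_embed I (conj_vec z) = slice_embed (- I) z.
Proof.
apply/rowP => j; rewrite !mxE; case: (z 0 j) => a b /=.
by rewrite scaleNr scalerN.
Qed.

Lemma conj_path_start (g : cpath R n) j :
  complex.Im ((conj_vec \o g) (@t0 R) 0 j) = 0.
Proof.
move: (cpath_start g j); rewrite /= mxE.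
by case: (g _ 0 j) => a b /= ->; rewrite oppr0.
Qed.

Lemma conj_path_continuous (g : cpath R n) : continuous (conj_vec \o g).
Proof.
move=> t; apply: continuous_comp; first exact: cpath_continuous.
exact: conj_vec_continuous.
Qed.

Definition conj_path (g : cpath R n) : cpath R n :=
  CPath (@conj_path_continuous g) (conj_path_start g).

Lemma lift_conj (g : cpath R n) I : lift (conj_path g) I = lift g (- I).
Proof. by apply/funext => t; rewrite /lift /= slice_embed_conj. Qed.

Lemma path_units_conj Om (g : cpath R n) I :
  path_units Om g I -> path_units Om (conj_path g) (- I).
Proof. by case=> sI gI; split; [exact: sphereN|rewrite lift_conj opprK]. Qed.

End Embedding.

Section Stems.
Variables (R : realType) (n : nat) (Om : set 'rV[quaternion R]_n).
Local Notation H := (quaternion R).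
Implicit Types (f h : Om -> H) (g : cpath R n) (I J : H) (q : Om).
Implicit Types A B C D : cpath R n -> H.

(** The two entries of the column in [path_slice], taken on all paths; only paths with an admissible
    unit constrain them. *)
Definition stem f A B := forall g I q, path_units Om g I ->
  \val q = lift g I (@t1 R) -> f q = A g + I * B g.

Lemma path_sliceP f : path_slice Om f <-> exists A B, stem f A B.
Proof.
split=> [[F Ff]|[A [B fAB]]].
  (* The default 0 is harmless: an admissible unit places [g] in [paths_in Om]. *)
  pose c i g : H :=
    if pselect (paths_in Om g) is left gOm
    then F (SigSub (mem_set gOm)) i 0 else 0.
  exists (c 0), (c 1) => g I q gI qg; rewrite /c.
  case: pselect => [gOm|[]]; last by exists I.
  rewrite (Ff (SigSub (mem_set gOm)) I gI q qg) !mxE big_ord_recl big_ord1.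
  rewrite !mxE /= mul1r.
  by congr (_ + I * F _ _ _); apply/val_inj.
exists (fun g : paths_in Om => col2 (A (\val g)) (B (\val g))) => g I gI q qg.
by rewrite (fAB _ _ _ gI qg) !mxE big_ord_recl big_ord1 !mxE /= mul1r.
Qed.

Lemma lift_end g I : path_units Om g I -> exists q, \val q = lift g I (@t1 R).
Proof.
case=> _ gI; have h : lift g I (@t1 R) \in Om.
  by rewrite inE; apply: gI; exists (@t1 R).
by exists (SigSub h).
Qed.

Hypothesis Om_stem : self_stem_preserving Om.

Lemma path_through q :
  exists g I, path_units Om g I /\ \val q = lift g I (@t1 R).
Proof.
case: Om_stem => /(_ (\val q) (set_valP q)) [g _ [I gI <-]] _.
by exists g, I.
Qed.

Lemma stem_inj f h A B C D : stem f A B -> stem h C D -> A =1 C -> B =1 D ->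
  f = h.
Proof.
move=> fAB hCD AC BD; apply/funext => q; have [g [I [gI qg]]] := path_through q.
by rewrite (fAB _ _ _ gI qg) (hCD _ _ _ gI qg) AC BD.
Qed.

(** Endpoints equal along [I] come from equal endpoints in [Cn], so [I] cannot be the only common
    unit. With [a = b] this yields a second unit for a single path. *)
Lemma second_unit a b I : path_units Om a I -> path_units Om b I ->
  lift a I (@t1 R) = lift b I (@t1 R) ->
  exists J, [/\ I <> J, path_units Om a J & path_units Om b J].
Proof.
move=> aI bI; rewrite /lift /= => /(slice_embed_inj aI.1) ab.
have [_ [_ /(_ a b (ex_intro _ I aI) (ex_intro _ I bI) ab) ne1]] := Om_stem.
have [J IJ [aJ bJ]] := card_neq1_distinct ne1 (conj aI bI).
by exists J.
Qed.

(** * Recovering the stem of one path-slice function *)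

Section OneFunction.
Variables (f : Om -> H) (A B : cpath R n -> H).
Hypothesis fAB : stem f A B.

(** Every admissible pair of units inverts to the same column, so the choice made by [xget] is
    immaterial. *)
Lemma stem_valueE g : paths_in Om g -> stem_value f g = col2 (A g) (B g).
Proof.
case=> I gI; apply: xget_unique => [|_ [K [L [p [q [KL gK gL [pK qL] ->]]]]]].
  have [J [IJ _ gJ]] := second_unit gI gI erefl.
  have [p pI] := lift_end gI; have [q qJ] := lift_end gJ.
  exists I, J, p, q; split=> //.
  by rewrite (fAB gI pI) (fAB gJ qJ) inv_slice_mxE //; [case: gI|case: gJ].
by rewrite (fAB gK pK) (fAB gL qL) inv_slice_mxE //; [case: gK|case: gL].
Qed.

(** The paths also end together along a second common unit, and two units determine the
    coefficients. *)
Lemma stem_same_end a b I : path_units Om a I -> path_units Om b I ->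
  lift a I (@t1 R) = lift b I (@t1 R) -> A a = A b /\ B a = B b.
Proof.
move=> aI bI ab; have [J [IJ aJ bJ]] := second_unit aI bI ab.
have abJ : lift a J (@t1 R) = lift b J (@t1 R).
  by move: ab; rewrite /lift /= => /(slice_embed_inj aI.1) ->.
have [p pI] := lift_end aI; have [q qJ] := lift_end aJ.
apply: (slice_coef_unique IJ).
  by rewrite -(fAB aI pI) -(fAB bI (etrans pI ab)).
by rewrite -(fAB aJ qJ) -(fAB bJ (etrans qJ abJ)).
Qed.

(** The [K]-lift of [g] is the [- K]-lift of its conjugate; comparing values for two units [K] gives
    the signs. *)
Lemma stem_conj g : paths_in Om g ->
  A (conj_path g) = A g /\ B (conj_path g) = - B g.
Proof.
case=> I gI; have [J [IJ _ gJ]] := second_unit gI gI erefl.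
suff [-> ->] : A g = A (conj_path g) /\ B g = - B (conj_path g).
  by rewrite opprK.
have hK K : path_units Om g K ->
    A g + K * B g = A (conj_path g) + K * - B (conj_path g).
  move=> gK; have [p pK] := lift_end gK.
  rewrite -(fAB gK pK) (fAB (path_units_conj gK)) ?mulNr ?mulrN //.
  by rewrite lift_conj opprK.
exact: (slice_coef_unique IJ (hK _ gI) (hK _ gJ)).
Qed.

(** A real endpoint is the same for all units, so [A g + I * B g] and [A g + J * B g] are both
    [f q]. *)
Lemma stem_real g I q : path_units Om g I -> \val q = lift g I (@t1 R) ->
  realHn (\val q) -> A g = f q /\ B g = 0.
Proof.
move=> gI qI; have [J [IJ _ gJ]] := second_unit gI gI erefl.
rewrite qI /lift /= (realHn_embed _ gI.1) => /forallP /= im0.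
have qJ : \val q = lift g J (@t1 R).
  rewrite qI; apply/rowP => j; rewrite !mxE.
  by have /eqP -> := im0 j; rewrite !scale0r.
by apply: (slice_coef_unique IJ); rewrite mulr0 addr0;
  [rewrite -(fAB gI qI)|rewrite -(fAB gJ qJ)].
Qed.

(** By [stem_same_end], all paths reaching [q] along its slice unit have the same stem. *)
Lemma point_stem_nonreal g q : ~~ realHn (\val q) ->
  path_units Om g (slice_unit (\val q)) ->
  \val q = lift g (slice_unit (\val q)) (@t1 R) ->
  point_stem f q = col2 (A g) (B g).
Proof.
move=> /negbTE qreal; rewrite /point_stem qreal; set K := slice_unit _ => gK qK.
apply: xget_unique => [|_ [a [aOm aK qa ->]]].
  by exists g; split=> //; [exists K|case: gK|rewrite stem_valueE //; exists K].
rewrite stem_valueE //.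
have aK' : path_units Om a K by split=> //; case: gK.
by have [-> ->] := stem_same_end aK' gK (etrans qa qK).
Qed.

End OneFunction.

(* When the path is taken along minus the slice unit of its endpoint, the
   conjugate path is the one seen by the star product, and the two sign changes
   compensate. *)
Lemma stem_star f h A B C D : stem f A B -> stem h C D ->
  stem (star Om f h) (fun g => A g * C g - B g * D g)
                     (fun g => A g * D g + B g * C g).
Proof.
move=> fAB hCD g I q gI qI.
(* The value of the star product when the slice unit is [I]; [I * I = -1] produces the term
   [- B g * D g]. *)
have expand : f q * C g + I * f q * D g =
    A g * C g - B g * D g + I * (A g * D g + B g * C g).
  rewrite (fAB _ _ _ gI qI) !mulrDr !mulrDl !mulrA.
  rewrite (sphere_sqr gI.1) mulN1r mulNr.
  by rewrite [I * A g * D g - _]addrC addrACA [I * B g * C g + _]addrC.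
rewrite -expand /star !mxE big_ord_recl big_ord1 !mxE /=.
have [qreal|qreal] := boolP (realHn (\val q)).
  have [Cg Dg] := stem_real hCD gI qI qreal.
  by rewrite /point_stem qreal !mxE /= Cg Dg !mulr0.
have qnr : ~~ realHn (slice_embed I (g (@t1 R))).
  by rewrite -[slice_embed _ _]qI.
have [] := slice_unit_embed gI.1 qnr; rewrite -[slice_embed _ _]qI => KI.
  by rewrite (point_stem_nonreal hCD qreal (g := g)) ?KI // !mxE.
have gOm : paths_in Om g by exists I.
rewrite (point_stem_nonreal hCD qreal (g := conj_path g)) ?KI.
- have [-> ->] := stem_conj hCD gOm.
  by rewrite !mxE /= !mulNr mulrN opprK.
- exact: path_units_conj.
- by rewrite lift_conj opprK.
Qed.

(** This one combination serves sums, opposites, real multiples and bilinearity. *)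
Lemma stem_add (a : R) f h A B C D : stem f A B -> stem h C D ->
  stem (a *: f + h) (a *: A + C) (a *: B + D).
Proof.
move=> fAB hCD g I q gI qI; rewrite !fctE (fAB _ _ _ gI qI) (hCD _ _ _ gI qI).
by rewrite mulrDr scalerDr scalerAr addrACA.
Qed.

Lemma stem_cst (c : H) : stem (cst c) (cst c) (cst 0).
Proof. by move=> g I q _ _; rewrite /cst mulr0 addr0. Qed.

End Stems.

(** * The algebra axioms, checked on stems *)

Theorem theorem5p3 (R : realType) (n : nat) (n_gt0 : (0 < n)%N)
  (Om : set 'rV[quaternion R]_n)
  (Om_slice : Om `<=` slice_cone R n)
  (Om_stem : self_stem_preserving Om) :
  assoc_unital_algebra (path_slice Om) (star Om).
Proof.
have PS0 : path_slice Om 0.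
  by apply/path_sliceP; do 2!eexists; exact: (stem_cst (0 : quaternion R)).
have PSD a u v : path_slice Om u -> path_slice Om v ->
    path_slice Om (a *: u + v).
  move=> /path_sliceP[A [B uAB]] /path_sliceP[C [D vCD]].
  by apply/path_sliceP; do 2!eexists; exact: stem_add uAB vCD.
split; first split=> //.
- by move=> u v uPS vPS; rewrite -[u]scale1r; exact: PSD.
- by move=> u uPS; rewrite -scaleN1r -[X in path_slice _ X]addr0; exact: PSD.
- by move=> a u uPS; rewrite -[X in path_slice _ X]addr0; exact: PSD.
- move=> u v /path_sliceP[A [B uAB]] /path_sliceP[C [D vCD]].
  by apply/path_sliceP; do 2!eexists; exact: (stem_star Om_stem uAB vCD).
- move=> a u v w /path_sliceP[A [B uAB]] /path_sliceP[C [D vCD]].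
  move=> /path_sliceP[E [G wEG]].
  split.
    apply: (stem_inj Om_stem (stem_star Om_stem (stem_add a uAB vCD) wEG)
      (stem_add a (stem_star Om_stem uAB wEG) (stem_star Om_stem vCD wEG))) => g;
      rewrite !fctE !mulrDl -!scalerAl.
      by rewrite scalerBr opprD addrACA.
    by rewrite scalerDr addrACA.
  apply: (stem_inj Om_stem (stem_star Om_stem wEG (stem_add a uAB vCD))
      (stem_add a (stem_star Om_stem wEG uAB) (stem_star Om_stem wEG vCD))) => g;
      rewrite !fctE !mulrDr -!scalerAr.
    by rewrite scalerBr opprD addrACA.
  by rewrite scalerDr addrACA.
- move=> u v w /path_sliceP[A [B uAB]] /path_sliceP[C [D vCD]].
  move=> /path_sliceP[E [G wEG]].
  (* Both stems expand to the same triple products, in different order of summation; no factors are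
     commuted. *)
  apply: (stem_inj Om_stem (stem_star Om_stem uAB (stem_star Om_stem vCD wEG))
      (stem_star Om_stem (stem_star Om_stem uAB vCD) wEG)) => g;
    rewrite !(mulrBl, mulrBr, mulrDl, mulrDr) !mulrA.
    by rewrite !opprD [RHS]addrAC !addrA.
  by rewrite [RHS]addrAC !addrA.
(* The constant 1 has stem (1, 0), the unit for the multiplication of pairs. *)
exists (cst 1) => [|u /path_sliceP[A [B uAB]]].
  by apply/path_sliceP; do 2!eexists; exact: stem_cst.
by split; [apply: (stem_inj Om_stem (stem_star Om_stem (stem_cst 1) uAB) uAB)
          |apply: (stem_inj Om_stem (stem_star Om_stem uAB (stem_cst 1)) uAB)] => g;
  rewrite /cst !(mul0r, mulr0, mul1r, mulr1, subr0, addr0, add0r).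
Qed.
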